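(* Consider the contextual search problem in dimension $d$ with the symmetric loss $\ell(\theta,p)=|\theta-p|$. The learner that in every round guesses $p_t=\frac12(\underline p_t+\overline p_t)$ has total loss $\sum_{t=1}^T|\langle u_t,v\rangle-p_t|$ bounded by $2^{O(d)}$, uniformly over $T$, over $v\in[0,1]^d$ and over the adversary.
   Context: Contextual search problem in dimension $d$: an adversary fixes $v\in[0,1]^d$. In each round $t=1,\dots,T$ the adversary chooses a unit vector $u_t\in\mathbb{R}^d$, the learner chooses $p_t\in\mathbb{R}$, incurs loss $\ell(\langle u_t,v\rangle,p_t)$ and learns the sign of $\langle u_t,v\rangle-p_t$. Knowledge sets: $S_1=[0,1]^d$, $S_{t+1}=\{x\in S_t:\langle u_t,x\rangle\ge p_t\}$ if $p_t\le\langle u_t,v\rangle$ was learned, else $S_{t+1}=\{x\in S_t:\langle u_t,x\rangle\le p_t\}$. Here $\underline p_t=\min_{x\in S_t}\langle u_t,x\rangle$ and $\overline p_t=\max_{x\in S_t}\langle u_t,x\rangle$. *)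

(* Defs.v *)
From mathcomp Require Import all_boot all_order all_algebra.
From mathcomp Require Import all_classical all_reals all_analysis.

Set Implicit Arguments.
Unset Strict Implicit.
Unset Printing Implicit Defensive.

Import Order.TTheory GRing.Theory Num.Theory.
Import numFieldNormedType.Exports.

Local Open Scope classical_set_scope.
Local Open Scope ring_scope.

Definition dot (R : realType) (d : nat) (u x : 'rV[R]_d) : R :=
  \sum_(i < d) u ord0 i * x ord0 i.

(* The norm `|u| carried by 'rV[R]_d is the sup norm, hence this definition. *)
Definition eucl_norm (R : realType) (d : nat) (u : 'rV[R]_d) : R :=
  Num.sqrt (dot u u).

Definition unit_cube (R : realType) (d : nat) : set 'rV[R]_d :=
  [set x | forall i, 0 <= x ord0 i <= 1].

(* On the sets reached by the protocol, inf and sup are a minimum and a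
   maximum: see lower_is_min and upper_is_max. *)
Definition lower (R : realType) (d : nat) (S : set 'rV[R]_d) (u : 'rV[R]_d) : R :=
  inf [set dot u x | x in S].

Definition upper (R : realType) (d : nat) (S : set 'rV[R]_d) (u : 'rV[R]_d) : R :=
  sup [set dot u x | x in S].

(* A learner computes its guess from the current knowledge set and direction,
   and has no other access to the hidden point. *)
Definition learner (R : realType) (d : nat) : Type :=
  set 'rV[R]_d -> 'rV[R]_d -> R.

(* Rounds are numbered from 0. A tie p = <u, v> counts as p <= <u, v>. *)
Fixpoint knowledge_set (R : realType) (d : nat) (L : learner R d)
    (v : 'rV[R]_d) (u : nat -> 'rV[R]_d) (t : nat) : set 'rV[R]_d :=
  if t is s.+1 then
    let S := knowledge_set L v u s in
    let p := L S (u s) in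
    if p <= dot (u s) v then [set x | S x /\ p <= dot (u s) x]
    else [set x | S x /\ dot (u s) x <= p]
  else @unit_cube R d.

Definition guess (R : realType) (d : nat) (L : learner R d)
    (v : 'rV[R]_d) (u : nat -> 'rV[R]_d) (t : nat) : R :=
  L (knowledge_set L v u t) (u t).

Definition symmetric_loss (R : realType) (theta p : R) : R := `|theta - p|.

Definition total_loss (R : realType) (d : nat) (loss : R -> R -> R)
    (L : learner R d) (v : 'rV[R]_d) (u : nat -> 'rV[R]_d) (T : nat) : R :=
  \sum_(t < T) loss (dot (u t) v) (guess L v u t).

Definition midpoint_learner (R : realType) (d : nat) : learner R d :=
  fun S u => 2^-1 * (lower S u + upper S u).

Lemma dot_continuous (R : realType) (d : nat) (u : 'rV[R]_d) :
  continuous (dot u).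
Proof.
have c i : continuous (fun x : 'rV[R]_d => u ord0 i * x ord0 i).
  move=> x.
  apply: (@continuous_comp _ _ _ (fun x : 'rV[R]_d => x ord0 i) ( *%R (u ord0 i))).
    exact: coord_continuous.
  exact: mulrl_continuous.
have add_cont := @pseudometric_normed_Zmodule.add_continuous R R^o.
exact: (@continuous_big R _ +%R 0 xpredT add_cont _ _ _ (fun i _ => c i)).
Qed.

Lemma knowledge_set_mem (R : realType) (d : nat) (L : learner R d)
    (v : 'rV[R]_d) (u : nat -> 'rV[R]_d) (t : nat) :
  unit_cube v -> knowledge_set L v u t v.
Proof.
move=> v01; elim: t => [//|t IH] /=.
by case: leP => h; split=> //; exact: ltW.
Qed.

Lemma knowledge_set_compact (R : realType) (d : nat) (L : learner R d)
    (v : 'rV[R]_d) (u : nat -> 'rV[R]_d) (t : nat) :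
  compact (knowledge_set L v u t).
Proof.
elim: t => [|t IH] /=.
  have -> : @unit_cube R d = [set x | forall i, `[0, 1]%classic (x ord0 i)].
    by apply/seteqP; split=> x /= h i; move: (h i); rewrite in_itv.
  apply: (@rV_compact R d (fun _ => `[0, 1]%classic)) => i.
  exact: segment_compact.
case: ifP => _.
- apply: (@compact_closedI _ _ [set x | _ <= dot (u t) x]) => //.
  by apply: (preimage_closed _ (@closed_ge R _)) => x _; exact: dot_continuous.
- apply: (@compact_closedI _ _ [set x | dot (u t) x <= _]) => //.
  by apply: (preimage_closed _ (@closed_le R _)) => x _; exact: dot_continuous.
Qed.

Lemma lower_is_min (R : realType) (d : nat) (L : learner R d)
    (v : 'rV[R]_d) (u : nat -> 'rV[R]_d) (t : nat) (w : 'rV[R]_d) :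
  unit_cube v ->
  let S := knowledge_set L v u t in
  (exists2 x, S x & dot w x = lower S w) /\
  (forall x, S x -> lower S w <= dot w x).
Proof.
move=> v01 S.
have Sv : S v by exact: knowledge_set_mem.
have [|||c] := @compact_EVT_min _ R (dot w) S.
- by exists v.
- exact: knowledge_set_compact.
- exact/continuous_subspaceT/dot_continuous.
rewrite inE => Sc cmin.
have cE : lower S w = dot w c.
  apply/eqP; rewrite eq_le; apply/andP; split.
    apply: ge_inf; last by exists c.
    by exists (dot w c) => _ [x Sx <-]; apply: cmin; rewrite inE.
  apply: lb_le_inf; first by exists (dot w c), c.
  by move=> _ [x Sx <-]; apply: cmin; rewrite inE.
by split=> [|x Sx]; rewrite ?cE; [exists c | apply: cmin; rewrite inE].
Qed.

Lemma upper_is_max (R : realType) (d : nat) (L : learner R d)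
    (v : 'rV[R]_d) (u : nat -> 'rV[R]_d) (t : nat) (w : 'rV[R]_d) :
  unit_cube v ->
  let S := knowledge_set L v u t in
  (exists2 x, S x & dot w x = upper S w) /\
  (forall x, S x -> dot w x <= upper S w).
Proof.
move=> v01 S.
have Sv : S v by exact: knowledge_set_mem.
have [|||c] := @compact_EVT_max _ R (dot w) S.
- by exists v.
- exact: knowledge_set_compact.
- exact/continuous_subspaceT/dot_continuous.
rewrite inE => Sc cmax.
have cE : upper S w = dot w c.
  apply/eqP; rewrite eq_le; apply/andP; split.
    apply: ge_sup; first by exists (dot w c), c.
    by move=> _ [x Sx <-]; apply: cmax; rewrite inE.
  apply: ub_le_sup; last by exists c.
  by exists (dot w c) => _ [x Sx <-]; apply: cmax; rewrite inE.
by split=> [|x Sx]; rewrite ?cE; [exists c | apply: cmax; rewrite inE].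
Qed.

(* Main.v *)
Require Import Defs.
From mathcomp Require Import all_boot all_order all_algebra.
From mathcomp Require Import all_classical all_reals all_analysis.
From mathcomp Require Import zify ring lra.

(* Let N_k(S) be the number of grid cells of side 2^-k that meet S. Suppose the
   width w of S in direction u exceeds 4 d 2^-k, and let x0 be the point of S
   extremal on the side that the midpoint cut discards. The contraction of S by
   1/4 towards x0 lies at distance at least w/4 from the surviving half S' in
   direction u, so its cells miss S'; as it uses at least N_k(S)/5^d cells, we
   get N_k(S') <= (1 - 5^-d) N_k(S), a drop of 5^-d in ln N_k. The potential
   \sum_k 2^-k ln N_k(S) is O(d) on the cube and never negative, and its total
   decrease pays for all the widths up to a factor 2^O(d). *)

Set Implicit Arguments.
Unset Strict Implicit.
Unset Printing Implicit Defensive.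

Import Order.TTheory GRing.Theory Num.Theory.

Local Open Scope ring_scope.

(** * Grid cells of side [2^-k] *)

(** Cells are half-open, so a coordinate equal to [1] has index [2 ^ k]; hence [2 ^ k + 1] values
    per coordinate. *)
Definition cell (R : realType) (d k : nat) (x : 'rV[R]_d) :
    {ffun 'I_d -> 'I_(2 ^ k).+1} :=
  [ffun i => inord (Num.truncn (2 ^+ k * x ord0 i))].

Definition cells (R : realType) (d k : nat) (S : set 'rV[R]_d) :
    {set {ffun 'I_d -> 'I_(2 ^ k).+1}} :=
  [set g | `[< exists2 x, S x & cell k x = g >]]%SET.

Lemma cellsP (R : realType) (d k : nat) (S : set 'rV[R]_d) g :
  reflect (exists2 x, S x & cell k x = g) (g \in cells k S).
Proof. by rewrite inE; exact: asboolP. Qed.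

Lemma card_cells_gt0 (R : realType) (d k : nat) (S : set 'rV[R]_d) x :
  S x -> (0 < #|cells k S|)%N.
Proof.
by move=> Sx; apply/card_gt0P; exists (cell k x); apply/cellsP; exists x.
Qed.

Lemma cell_itv (R : realType) (d k : nat) (x : 'rV[R]_d) i : unit_cube x ->
  (cell k x i)%:R <= 2 ^+ k * x ord0 i < (cell k x i)%:R + 1.
Proof.
move=> /(_ i) /andP[x0 x1].
have y0 : 0 <= 2 ^+ k * x ord0 i by rewrite mulr_ge0 ?exprn_ge0.
rewrite ffunE inordK; first by rewrite natr1 truncn_itv.
rewrite truncn_lt_nat// -[(2 ^ k).+1%:R]natr1 natrX.
have : 2 ^+ k * x ord0 i <= 2 ^+ k by rewrite ler_piMr ?exprn_ge0.
by lra.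
Qed.

Lemma cell_eq_dist (R : realType) (d k : nat) (x y : 'rV[R]_d) i :
  unit_cube x -> unit_cube y -> cell k x = cell k y ->
  `|2 ^+ k * x ord0 i - 2 ^+ k * y ord0 i| < 1.
Proof.
move=> x01 y01 xy; have := cell_itv k i x01; have := cell_itv k i y01.
by rewrite xy ltr_norml; lra.
Qed.

(* A cell g is sent to the cell of the contraction of a point of g. The fibres
   have at most 5 values per coordinate, told apart by their residues mod 5. *)
Lemma card_cells_setD (R : realType) (d k : nat) (S S' : set 'rV[R]_d) x0 :
  (forall x, S x -> unit_cube x) ->
  (forall x, S x -> S (x0 + 4^-1 *: (x - x0))) ->
  (forall x y, S x -> S' y ->
    cell k (x0 + 4^-1 *: (x - x0)) <> cell k y) ->
  (#|cells k S| <= #|cells k S :\: cells k S'| * 5 ^ d)%N.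
Proof.
move=> S01 Sc SS'.
have /choice[s sP] : forall g, exists x, g \in cells k S ->
    S x /\ cell k x = g.
  move=> g; case: (boolP (g \in cells k S)) => [/cellsP[x]|_]; last by exists 0.
  by exists x.
pose c g := x0 + 4^-1 *: (s g - x0).
pose f g := (cell k (c g),
  [ffun i => inord (g i %% 5)] : {ffun 'I_d -> 'I_5}).
have f_inj : {in cells k S &, injective f}.
  move=> g h gS hS [cgh mgh].
  have [Sg gE] := sP _ gS; have [Sh hE] := sP _ hS.
  apply/ffunP => i; apply: val_inj => /=.
  have m5 : (g i %% 5 = h i %% 5)%N.
    move/ffunP/(_ i)/(congr1 val): mgh.
    by rewrite !ffunE /= !inordK ?ltn_pmod.
  have := cell_eq_dist i (S01 _ (Sc _ Sg)) (S01 _ (Sc _ Sh)) cgh.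
  have := cell_itv k i (S01 _ Sg); have := cell_itv k i (S01 _ Sh).
  rewrite gE hE !mxE ltr_norml => hi gi.
  set a := _ * s g ord0 i in gi *; set b := _ * s h ord0 i in hi *.
  (* Where 5 comes from: the contracted points share a cell, so [|a - b| < 4], and the integer parts
     of [a] and [b] differ by less than 5. *)
  have -> : 2 ^+ k * (x0 ord0 i + 4^-1 * (s g ord0 i - x0 ord0 i)) -
      2 ^+ k * (x0 ord0 i + 4^-1 * (s h ord0 i - x0 ord0 i)) = (a - b) / 4.
    by rewrite /a /b; field.
  move=> ab.
  have gh5 : (g i < h i + 5)%N by rewrite -(ltr_nat R) natrD; lra.
  have hg5 : (h i < g i + 5)%N by rewrite -(ltr_nat R) natrD; lra.
  by move: (val (g i)) (val (h i)) m5 gh5 hg5 => m n; lia.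
rewrite -(card_in_imset f_inj).
apply: (@leq_trans #|finset.setX (cells k S :\: cells k S')
    [set: {ffun 'I_d -> 'I_5}]%SET|).
  apply/subset_leq_card/fintype.subsetP => _ /imsetP[g gS ->].
  have [Sg _] := sP _ gS.
  rewrite finset.in_setX finset.in_setT andbT finset.in_setD; apply/andP; split.
    by apply/negP => /cellsP[y S'y yE]; apply: (SS' _ _ Sg S'y).
  by apply/cellsP; exists (c g) => //; exact: Sc.
by rewrite cardsX cardsT card_ffun !card_ord.
Qed.

Lemma cellsS (R : realType) (d k : nat) (S S' : set 'rV[R]_d) :
  (forall x, S' x -> S x) -> cells k S' \subset cells k S.
Proof.
move=> S'S; apply/fintype.subsetP => g /cellsP[x S'x <-].
by apply/cellsP; exists x => //; exact: S'S.
Qed.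

(** Apply [ln y <= y - 1] at [y = m / n]: the drop is at least [1 - m / n], the fraction of cells
    lost. *)
Lemma ln_card_drop (R : realType) (A m n : nat) :
  (0 < A)%N -> (0 < m)%N -> (m <= n)%N -> (n <= (n - m) * A)%N ->
  A%:R^-1 <= ln n%:R - ln m%:R :> R.
Proof.
move=> A0 m0 mn nA.
have mR : 0 < m%:R :> R by rewrite ltr0n.
have nR : 0 < n%:R :> R by rewrite ltr0n (leq_trans m0).
have AR : 0 < A%:R :> R by rewrite ltr0n.
have := @le_ln1Dx R (m%:R / n%:R - 1).
rewrite addrCA subrr addr0 ln_div// => h.
have : A%:R^-1 <= 1 - m%:R / n%:R :> R.
  rewrite -(ler_pM2r nR) mulrBl mul1r divfK ?gt_eqF// ler_pdivrMl//.
  by rewrite -natrB// -natrM ler_nat mulnC.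
have : -1 < m%:R / n%:R - 1 :> R by rewrite ltrBrDr addrC subrr divr_gt0.
by move=> /h; lra.
Qed.

(** * Linear forms and convexity of knowledge sets *)

Lemma dotB (R : realType) (d : nat) (u x y : 'rV[R]_d) :
  dot u (x - y) = dot u x - dot u y.
Proof. by rewrite /dot -sumrB; apply: eq_bigr => i _; rewrite !mxE mulrBr. Qed.

Lemma dotD (R : realType) (d : nat) (u x y : 'rV[R]_d) :
  dot u (x + y) = dot u x + dot u y.
Proof.
by rewrite /dot -big_split; apply: eq_bigr => i _; rewrite !mxE mulrDr.
Qed.

Lemma dotZ (R : realType) (d : nat) (u x : 'rV[R]_d) a :
  dot u (a *: x) = a * dot u x.
Proof.
by rewrite /dot mulr_sumr; apply: eq_bigr => i _; rewrite !mxE mulrCA.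
Qed.

Lemma coord_le_eucl_norm (R : realType) (d : nat) (u : 'rV[R]_d) i :
  eucl_norm u = 1 -> `|u ord0 i| <= 1.
Proof.
move=> u1; rewrite -(ler_pXn2r (n := 2)) ?nnegrE// expr1n.
rewrite real_normK ?num_real//.
have uu : dot u u = 1.
  rewrite -(@sqr_sqrtr _ (dot u u)) -?/(eucl_norm u) ?u1 ?expr1n//.
  by apply: sumr_ge0 => j _; rewrite -expr2 sqr_ge0.
rewrite -uu /dot (bigD1 i)//= expr2 lerDl.
by apply: sumr_ge0 => j _; rewrite -expr2 sqr_ge0.
Qed.

Lemma dot_le (R : realType) (d : nat) (u x : 'rV[R]_d) e :
  eucl_norm u = 1 -> (forall i, `|x ord0 i| <= e) -> `|dot u x| <= d%:R * e.
Proof.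
move=> u1 xe; apply: le_trans (ler_norm_sum _ _ _) _.
have -> : d%:R * e = \sum_(i < d) e by rewrite sumr_const card_ord mulr_natl.
apply: ler_sum => i _; rewrite normrM -[leRHS]mul1r.
by apply: ler_pM => //; exact: coord_le_eucl_norm.
Qed.

Lemma knowledge_set_sub_cube (R : realType) (d : nat) (L : learner R d)
    v u t x :
  knowledge_set L v u t x -> unit_cube x.
Proof. by elim: t x => [//|t IH] x /=; case: ifP => _ [/IH]. Qed.

Lemma knowledge_setS (R : realType) (d : nat) (L : learner R d) v u t x :
  knowledge_set L v u t.+1 x -> knowledge_set L v u t x.
Proof. by rewrite /=; case: ifP => _ []. Qed.

Lemma knowledge_set_convex (R : realType) (d : nat) (L : learner R d)
    v u t x y a :
  0 <= a <= 1 -> knowledge_set L v u t x -> knowledge_set L v u t y ->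
  knowledge_set L v u t (x + a *: (y - x)).
Proof.
move=> /andP[a0 a1]; elim: t x y => [|t IH] x y /=.
  by move=> x01 y01 i; rewrite !mxE; have := x01 i; have := y01 i; nra.
by case: ifP => _ [Sx px] [Sy py]; (split; first exact: IH);
  rewrite dotD dotZ dotB; nra.
Qed.

(** * Dyadic scales of the width and the effect of one cut *)

(** The largest scale [a / 2^k] below [w] is at least [w / 2], so the geometric sum from there down
    to [a / 2^K] misses [w] by at most its last term. If no scale is below [w], the first summand
    suffices. *)
Lemma width_sum (R : realType) (a w : R) (K : nat) : 0 <= a -> w <= a ->
  w <= a / 2 ^+ K + \sum_(k < K.+1) a / 2 ^+ k * (a / 2 ^+ k < w)%R%:R.
Proof.
move=> a0 wa; elim: K => [|K IH].
  rewrite expr0 divr1; apply: le_trans wa _; rewrite lerDl.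
  by apply: sumr_ge0 => k _; rewrite mulr_ge0// divr_ge0// exprn_ge0.
case: (leP w (a / 2 ^+ K.+1)) => h.
  apply: le_trans h _; rewrite lerDl.
  by apply: sumr_ge0 => k _; rewrite mulr_ge0// divr_ge0// exprn_ge0.
rewrite big_ord_recr /= h mulr1.
have -> : a / 2 ^+ K.+1 = a / 2 ^+ K / 2 by rewrite exprSr invfM mulrA.
by apply: le_trans IH _; set s := \sum_(_ < _) _; lra.
Qed.

Lemma cell_eq_dot (R : realType) (d k : nat) (u x y : 'rV[R]_d) :
  eucl_norm u = 1 -> unit_cube x -> unit_cube y -> cell k x = cell k y ->
  `|dot u x - dot u y| <= d%:R / 2 ^+ k.
Proof.
move=> u1 x01 y01 xy; rewrite -dotB; apply: dot_le => // i; rewrite !mxE.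
have k0 : 0 < 2 ^+ k :> R by rewrite exprn_gt0.
rewrite -(ler_pM2l k0) mulfV ?gt_eqF// -[X in X * `|_|]gtr0_norm// -normrM.
by rewrite mulrBr; exact/ltW/cell_eq_dist.
Qed.

Lemma ln_cells_midpoint_cut (R : realType) (d k : nat) (v : 'rV[R]_d) u t :
  let S := knowledge_set (@midpoint_learner R d) v u in
  unit_cube v -> eucl_norm (u t) = 1 ->
  4 * d%:R / 2 ^+ k < upper (S t) (u t) - lower (S t) (u t) ->
  (5 ^ d)%:R^-1 <= ln #|cells k (S t)|%:R - ln #|cells k (S t.+1)|%:R :> R.
Proof.
move=> S v01 u1 wide.
have Sv s : S s v by exact: knowledge_set_mem.
have SS x : S t.+1 x -> S t x by exact: knowledge_setS.
have S01 s x : S s x -> unit_cube x by exact: knowledge_set_sub_cube.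
have sub := cellsS k SS.
apply: ln_card_drop; rewrite ?expn_gt0 ?subset_leq_card//.
  exact: card_cells_gt0 (Sv _).
rewrite -cardsDS//.
have S4 x0 x : S t x0 -> S t x -> S t (x0 + 4^-1 *: (x - x0)).
  by move=> Sx0 Sx; apply: knowledge_set_convex => //; lra.
have [[xl Sxl xlE] lo] := lower_is_min (@midpoint_learner R d) u t (u t) v01.
have [[xu Sxu xuE] up] := upper_is_max (@midpoint_learner R d) u t (u t) v01.
rewrite -/S -/(S t) in Sxl xlE lo Sxu xuE up.
have far x0 x y : S t x0 -> S t x -> S t.+1 y ->
    cell k (x0 + 4^-1 *: (x - x0)) = cell k y ->
    `|3 / 4 * dot (u t) x0 + 4^-1 * dot (u t) x - dot (u t) y|
      <= d%:R / 2 ^+ k.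
  move=> Sx0 Sx Sy /(cell_eq_dot u1 (S01 _ _ (S4 _ _ Sx0 Sx)) (S01 _ _ Sy)).
  by rewrite dotD dotZ dotB; congr (`|_| <= _); field.
(* The contraction goes towards [xl] if the upper half survives, towards [xu] otherwise. Either way
   the gap to the cut is at least a quarter of the width, which by [wide] exceeds [d / 2^k], the
   variation of [dot (u t)] allowed in one cell by [far]. *)
case: (leP (guess (@midpoint_learner R d) v u t) (dot (u t) v)) => side.
- apply: (card_cells_setD (S01 t) (fun x => S4 xl x Sxl)) => x y Sx Sy /far.
  move=> /(_ Sxl Sx Sy); rewrite xlE ler_norml.
  have : lower (S t) (u t) + upper (S t) (u t) <= 2 * dot (u t) y.
    move: Sy; rewrite /S /= -/(guess _ _ _ _) side => -[_].
    by rewrite /guess /midpoint_learner -/(S t); lra.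
  by have := up _ Sx; lra.
- apply: (card_cells_setD (S01 t) (fun x => S4 xu x Sxu)) => x y Sx Sy /far.
  move=> /(_ Sxu Sx Sy); rewrite xuE ler_norml.
  have : 2 * dot (u t) y <= lower (S t) (u t) + upper (S t) (u t).
    move: Sy; rewrite /S /= -/(guess _ _ _ _) leNgt side => -[_].
    by rewrite /guess /midpoint_learner -/(S t); lra.
  by have := lo _ Sx; lra.
Qed.

(** * The multiscale potential *)

(** The sum over scales is cut off at [K] to stay finite; this costs the extra [4 d / 2^K] per round
    in [width_le_potential_drop]. *)
Definition potential (R : realType) (d K : nat) (S : set 'rV[R]_d) : R :=
  \sum_(k < K.+1) ln #|cells k S|%:R / 2 ^+ k.

Lemma potential_ge0 (R : realType) (d K : nat) (S : set 'rV[R]_d) x :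
  S x -> 0 <= potential K S.
Proof.
move=> Sx; apply: sumr_ge0 => k _; rewrite divr_ge0 ?exprn_ge0// ln_ge0//.
by rewrite ler1n (card_cells_gt0 _ Sx).
Qed.

Lemma sum_succ_div_exp2 (R : realType) (K : nat) :
  \sum_(k < K) k.+1%:R / 2 ^+ k <= 4 :> R.
Proof.
(* The bound 4 is the sum of the infinite series and does not carry an induction; the closed form
   does. *)
suff : \sum_(k < K) k.+1%:R / 2 ^+ k = 4 - (K.*2 + 4)%:R / 2 ^+ K :> R.
  by move=> ->; rewrite gerBl divr_ge0 ?exprn_ge0.
elim: K => [|K IH]; first by rewrite big_ord0 expr0 divr1 subrr.
rewrite big_ord_recr /= IH exprS -!mul2n !natrD !natrM -!natr1.
have : 2 ^+ K != 0 :> R by rewrite expf_neq0.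
by move=> ?; field.
Qed.

(** There are [(2^k + 1)^d <= 2^((k+1) d)] indices at scale [k] and [ln 2 <= 1], so each logarithm
    is at most [(k+1) d]. *)
Lemma potential_cube (R : realType) (d K : nat) (S : set 'rV[R]_d) :
  potential K S <= 4 * d%:R.
Proof.
apply: (@le_trans _ _ (\sum_(k < K.+1) k.+1%:R / 2 ^+ k * d%:R)); last first.
  by rewrite -mulr_suml ler_wpM2r// sum_succ_div_exp2.
apply: ler_sum => k _; rewrite mulrAC ler_wpM2r ?invr_ge0 ?exprn_ge0//.
(* An empty [S] has no cells, and [ln 0] is [0] by convention. *)
have [->|N0] := posnP #|cells k S|; first by rewrite ln0 ?mulr_ge0.
have N2 : (#|cells k S| <= 2 ^ (k.+1 * d))%N.
  apply: leq_trans (max_card _) _; rewrite card_ffun !card_ord expnM.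
  have [->|/leq_exp2r ->] := posnP d; first by rewrite !expn0.
  by rewrite expnS mul2n -addnn -addn1 leq_add2l expn_gt0.
apply: (@le_trans _ _ (ln (2 ^ (k.+1 * d))%:R)).
  by rewrite ler_ln ?posrE ?ltr0n ?expn_gt0// ler_nat.
rewrite natrX lnXn// -natrM -[leLHS]mulr_natl ler_piMr//.
by apply: le_trans (@le_ln1Dx R 1 _) _; lra.
Qed.

(** Split the width by [width_sum] with [a = 4 d]: each scale below the width is paid for by a drop
    of [5^-d] in its logarithm. *)
Lemma width_le_potential_drop (R : realType) (d K : nat) (v : 'rV[R]_d) u t :
  let S := knowledge_set (@midpoint_learner R d) v u in
  unit_cube v -> eucl_norm (u t) = 1 ->
  upper (S t) (u t) - lower (S t) (u t) <= 4 * d%:R / 2 ^+ K +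
    4 * d%:R * 5 ^+ d * (potential K (S t) - potential K (S t.+1)).
Proof.
move=> S v01 u1; set w := upper _ _ - _.
have wd : w <= 4 * d%:R.
  have [[xl Sxl xlE] _] := lower_is_min (@midpoint_learner R d) u t (u t) v01.
  have [[xu Sxu xuE] _] := upper_is_max (@midpoint_learner R d) u t (u t) v01.
  have xlu i : `|(xu - xl) ord0 i| <= 1.
    rewrite !mxE ler_norml.
    have := knowledge_set_sub_cube Sxl i; have := knowledge_set_sub_cube Sxu i.
    by lra.
  have := dot_le u1 xlu; rewrite dotB xuE xlE -/w ler_norml.
  have : 0 <= d%:R :> R by [].
  by lra.
apply: le_trans (width_sum K _ wd) _; first by rewrite mulr_ge0.
rewrite lerD2l /potential -sumrB mulr_sumr; apply: ler_sum => k _.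
rewrite -mulrBl [_ / 2 ^+ k in leRHS]mulrC mulrACA.
rewrite ler_wpM2l ?divr_ge0 ?mulr_ge0 ?exprn_ge0//.
have d5 : 0 < 5 ^+ d :> R by rewrite exprn_gt0.
rewrite -ler_pdivrMl//.
case: ltP => [wide|_] /=.
  by rewrite mulr1 -natrX; exact: ln_cells_midpoint_cut.
(* At scales not below the width nothing has to be paid; it is enough that a cut adds no cells. *)
rewrite mulr0 subr_ge0 ler_ln ?posrE ?ltr0n ?ler_nat.
- by apply/subset_leq_card/cellsS => x; exact: knowledge_setS.
- exact: (card_cells_gt0 _ (knowledge_set_mem _ _ _ v01)).
- exact: (card_cells_gt0 _ (knowledge_set_mem _ _ _ v01)).
Qed.

(** * Summation over the rounds *)

Lemma midpoint_loss_le_width (R : realType) (d : nat) (v : 'rV[R]_d) u t :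
  let S := knowledge_set (@midpoint_learner R d) v u t in
  unit_cube v ->
  symmetric_loss (dot (u t) v) (guess (@midpoint_learner R d) v u t)
    <= upper S (u t) - lower S (u t).
Proof.
move=> S v01; have Sv : S v by exact: knowledge_set_mem.
have [_ /(_ _ Sv) lo] := lower_is_min (@midpoint_learner R d) u t (u t) v01.
have [_ /(_ _ Sv) up] := upper_is_max (@midpoint_learner R d) u t (u t) v01.
rewrite -/S in lo up.
by rewrite /symmetric_loss /guess /midpoint_learner -/S ler_norml; lra.
Qed.

Theorem theorem33 (R : realType) :
  exists C : nat,
    forall (d : nat) (v : 'rV[R]_d) (u : nat -> 'rV[R]_d) (T : nat),
      (1 <= d)%N ->
      @unit_cube R d v ->
      (forall t : nat, (t < T)%N -> eucl_norm (u t) = 1) ->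
      total_loss (@symmetric_loss R) (@midpoint_learner R d) v u T
        <= 2 ^+ (C * d).
Proof.
(* With [x = 2^d >= 2], the final bound [4 d + 16 d^2 5^d] is at most [20 x^5], and another factor
   [x^5 >= 32] absorbs the 20. *)
exists 10%N => d v u T d1 v01 u1.
pose S := knowledge_set (@midpoint_learner R d) v u.
pose c : R := 4 * d%:R * 5 ^+ d.
(* The cutoff [K = T] makes the [T] truncation errors add up to at most [4 d], uniformly in [T]; the
   potential drops telescope. *)
apply: (@le_trans _ _ (\sum_(t < T) (4 * d%:R / 2 ^+ T +
    c * (potential T (S t) - potential T (S t.+1))))).
  apply: ler_sum => t _; apply: le_trans (midpoint_loss_le_width _ _ v01) _.
  by apply: width_le_potential_drop => //; exact: u1.
rewrite big_split /= sumr_const card_ord -mulr_sumr.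
have -> : \sum_(t < T) (potential T (S t) - potential T (S t.+1)) =
    potential T (S 0%N) - potential T (S T).
  rewrite -(big_mkord xpredT
    (fun t => potential T (S t) - potential T (S t.+1))).
  rewrite (telescope_sumr_eq (fun t => - potential T (S t))) => [||t _] //.
    by rewrite opprK addrC.
  by rewrite opprK addrC.
have ST0 : 0 <= potential T (S T).
  by apply: (@potential_ge0 _ _ _ _ v); exact: knowledge_set_mem.
have S04 := @potential_cube R d T (S 0%N).
have T2 : 4 * d%:R / 2 ^+ T *+ T <= 4 * d%:R :> R.
  rewrite -[leLHS]mulr_natr -mulrA ler_piMr ?mulr_ge0//.
  rewrite mulrC ler_pdivrMr ?exprn_gt0// mul1r -natrX ler_nat.
  exact/ltnW/ltn_expl.
apply: (@le_trans _ _ (4 * d%:R + c * (4 * d%:R))).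
  apply: lerD => //; apply: ler_wpM2l; last by lra.
  by rewrite !mulr_ge0 ?exprn_ge0.
(* Uses [d <= 2^d], [5 <= 2^3] and [20 <= 2^(5d)]. *)
rewrite /c -natrX.
have : (4 * d + 4 * d * 5 ^ d * (4 * d) <= 2 ^ (10 * d))%N.
  have dd : (d <= 2 ^ d)%N by exact/ltnW/ltn_expl.
  have d0 : (0 < 2 ^ d)%N by rewrite expn_gt0.
  have d2 : (2 <= 2 ^ d)%N by rewrite -[2%N in X in (X <= _)%N]expn1 leq_exp2l.
  have d5 : (5 ^ d <= (2 ^ d) ^ 3)%N by rewrite -expnM mulnC expnM leq_exp2r.
  have x5 : (2 ^ d <= (2 ^ d) ^ 5)%N by rewrite -{1}[(2 ^ d)%N]expn1 leq_pexp2l.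
  have y2 : (2 ^ 5 <= (2 ^ d) ^ 5)%N by rewrite leq_exp2r.
  have h : (4 * d * 5 ^ d * (4 * d) <= 16 * (2 ^ d) ^ 5)%N.
    have -> : (4 * d * 5 ^ d * (4 * d) = 16 * (d * 5 ^ d * d))%N by ring.
    have -> : ((2 ^ d) ^ 5 = 2 ^ d * (2 ^ d) ^ 3 * 2 ^ d)%N by ring.
    by rewrite leq_mul2l !leq_mul.
  have -> : (2 ^ (10 * d) = (2 ^ d) ^ 5 * (2 ^ d) ^ 5)%N.
    by rewrite -expnD -expnM mulnC.
  apply: leq_trans (leq_mul y2 (leqnn _)).
  by move: h x5 dd; lia.
by rewrite -(ler_nat R) natrD !natrM !natrX.
Qed.
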